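(* Let $G$ be a finite simple graph with $n$ vertices and let $H$ be a simple graph obtained from $G$ by adding a new vertex $v$ and some new edges joining $v$ with vertices in $V(G)$. If $a=(1,\ldots,1)\in\mathbb{N}^n$ is an irreducible $\alpha_0(G)$-cover of $\Upsilon(G)$ and $\alpha_0(H)=\alpha_0(G)+1$, then $a'=(a,1)=(1,\ldots,1)\in\mathbb{N}^{n+1}$ is an irreducible $\alpha_0(H)$-cover of $\Upsilon(H)$.
   Context: $\mathbb{N}=\{0,1,2,\ldots\}$. A vertex cover of a graph is a set of vertices meeting every edge; it is minimal if no proper subset is a vertex cover. For a graph $G$ with vertices $x_1,\ldots,x_n$, $\Upsilon(G)$ is the family of all minimal vertex covers of $G$, and $\alpha_0(G)$ is the minimum cardinality of a vertex cover of $G$. For $0\neq a\in\mathbb{N}^n$ and $b\in\mathbb{N}$, $a$ is a $b$-cover of $\Upsilon(G)$ if $\sum_{x_i\in C}a_i\geq b$ for every $C\in\Upsilon(G)$. A $b$-cover $a$ of $\Upsilon(G)$ is reducible if there are an $i$-cover $c$ and a $j$-cover $d$ of $\Upsilon(G)$ (with $i,j\in\mathbb{N}$; covers are nonzero vectors by definition) such that $a=c+d$ and $b=i+j$; otherwise it is irreducible. The last coordinate of $a'$ corresponds to the vertex $v$. *)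

(* Defs.v *)
From HB Require Import structures.
From mathcomp Require Import all_boot all_order all_algebra.

Set Implicit Arguments.
Unset Strict Implicit.
Unset Printing Implicit Defensive.

Import GRing.Theory.

Record sgraph (n : nat) := SGraph {
  adj :> rel 'I_n;
  adj_sym : symmetric adj;
  adj_irr : irreflexive adj
}.

Definition vcover n (G : sgraph n) (C : {set 'I_n}) : bool :=
  [forall x, forall y, G x y ==> (x \in C) || (y \in C)].

Definition Upsilon n (G : sgraph n) : {set {set 'I_n}} :=
  [set C | minset (vcover G) C].

(* The whole vertex set, a vertex cover of every graph, is the default point
   required by arg min; see vcoverT. *)
Definition alpha0 n (G : sgraph n) : nat :=
  #|[arg min_(C < [set: 'I_n] | vcover G C) #|C| ]|.

Lemma vcoverT n (G : sgraph n) : vcover G [set: 'I_n].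
Proof. by apply/'forall_forallP=> x y; rewrite inE implybT. Qed.

Definition is_cover n (Y : {set {set 'I_n}}) (b : nat) (a : 'rV[nat]_n) : Prop :=
  a <> 0%R /\ forall C, C \in Y -> b <= \sum_(i in C) a ord0 i.

Definition reducible n (Y : {set {set 'I_n}}) (b : nat) (a : 'rV[nat]_n) : Prop :=
  exists (c d : 'rV[nat]_n) (i j : nat),
    [/\ is_cover Y i c, is_cover Y j d, a = (c + d)%R & b = i + j].

Definition irreducible_cover n (Y : {set {set 'I_n}}) (b : nat)
    (a : 'rV[nat]_n) : Prop :=
  is_cover Y b a /\ ~ reducible Y b a.

(* The vertices of H are those of G, embedded by lshift 1, followed by the new
   vertex v = rshift n ord0; edges at v are unconstrained. *)
Definition adds_vertex n (G : sgraph n) (H : sgraph (n + 1)) : Prop :=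
  forall x y : 'I_n, H (lshift 1 x) (lshift 1 y) = G x y.

(* Main.v *)
Require Import Defs.
From HB Require Import structures.
From mathcomp Require Import all_boot all_order all_algebra.
From mathcomp Require Import zify.

(** In a decomposition [(1,...,1) = c + d] of [a'], say [d] is the summand with
    entry [1] at [v], and [c], [d] are an [i]-cover and a [j]-cover of [H]. If
    [C] covers [G] then [C] and [v] together cover [H], so on [V(G)] the
    vectors [c] and [d] weigh [C] by at least [i] and [j - 1]. If [j > 0] and
    [d] does not vanish on [V(G)], this decomposes [a]. If [j = 0], a minimum
    cover of [G] is too small to have [c]-weight [i = alpha0 G + 1]. If [d] is
    supported on [v], then [j = 0] because [V(G)] covers [H]. *)

Lemma alpha0_le n (G : sgraph n) (C : {set 'I_n}) :
  vcover G C -> alpha0 G <= #|C|.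
Proof. by rewrite /alpha0; case: arg_minnP => [|D _ h /h //]; apply: vcoverT. Qed.

Lemma alpha0_witness n (G : sgraph n) :
  exists2 C : {set 'I_n}, vcover G C & #|C| = alpha0 G.
Proof.
rewrite /alpha0; case: arg_minnP => [|C vC _]; first exact: vcoverT.
by exists C.
Qed.

Lemma Upsilon_vcover {n} {G : sgraph n} {C} : C \in Upsilon G -> vcover G C.
Proof. by rewrite inE => /minsetp. Qed.

(** Any vertex cover contains a minimal one, and passing to a larger set cannot lower the weight
    because entries are naturals. *)
Lemma is_cover_vcover {n} {G : sgraph n} {b} {a : 'rV[nat]_n} {C} :
  is_cover (Upsilon G) b a -> vcover G C -> b <= \sum_(i in C) a ord0 i.
Proof.
move=> [_ cov] /minset_exists [D mD /setIidPr sDC].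
apply: leq_trans (cov D _) _; first by rewrite inE.
by rewrite [leqRHS](big_setID D) /= sDC leq_addr.
Qed.

Definition with_new {n} (C : {set 'I_n}) : {set 'I_(n + 1)} :=
  [set k | if split k is inl x then x \in C else true].

Lemma in_with_new_lshift n (C : {set 'I_n}) x :
  (lshift 1 x \in with_new C) = (x \in C).
Proof. by rewrite inE (unsplitK (inl x)). Qed.

Lemma in_with_new_rshift n (C : {set 'I_n}) y : rshift n y \in with_new C.
Proof. by rewrite inE (unsplitK (inr y)). Qed.

Lemma vcover_with_new {n} {G : sgraph n} {H : sgraph (n + 1)} {C} :
  adds_vertex G H -> vcover G C -> vcover H (with_new C).
Proof.
move=> GH /'forall_'forall_implyP vC; apply/'forall_'forall_implyP => x y.
case: (split_ordP x) => k ->; last by rewrite in_with_new_rshift.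
case: (split_ordP y) => l ->; last by rewrite in_with_new_rshift orbT.
by rewrite GH !in_with_new_lshift => /vC.
Qed.

(** An edge missing this set would be a loop at [v]. *)
Lemma vcover_setC_new n (H : sgraph (n + 1)) : vcover H [set~ rshift n ord0].
Proof.
apply/'forall_'forall_implyP => x y Hxy; rewrite !inE -negb_and.
by apply/negP => /andP[/eqP ex /eqP ey]; move: Hxy; rewrite ex ey adj_irr.
Qed.

Lemma sum_with_new n (C : {set 'I_n}) (f : 'I_(n + 1) -> nat) :
  \sum_(k in with_new C) f k =
  \sum_(x in C) f (lshift 1 x) + f (rshift n ord0).
Proof.
rewrite big_split_ord /=; congr (_ + _).
  by apply: eq_bigl => x; rewrite in_with_new_lshift.
by under eq_bigl do rewrite in_with_new_rshift; rewrite big_ord1.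
Qed.

Lemma ones_not_sum_covers n (G : sgraph n) (H : sgraph (n + 1))
    (c d : 'rV[nat]_(n + 1)) (i j : nat) :
  adds_vertex G H ->
  ~ reducible (Upsilon G) (alpha0 G) (const_mx 1) ->
  (const_mx 1 = c + d)%R -> alpha0 G + 1 = i + j ->
  is_cover (Upsilon H) i c -> is_cover (Upsilon H) j d ->
  d ord0 (rshift n ord0) = 1 -> False.
Proof.
move=> GH irr cd1 ij cH dH dv.
have cdE k : c ord0 k + d ord0 k = 1 by move/rowP/(_ k): cd1; rewrite !mxE.
have cv : c ord0 (rshift n ord0) = 0 by move: (cdE (rshift n ord0)); lia.
have cG C : vcover G C -> i <= \sum_(x in C) c ord0 (lshift 1 x).
  move=> /(vcover_with_new GH)/(is_cover_vcover cH).
  by rewrite sum_with_new cv addn0.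
have dG C : vcover G C -> j <= \sum_(x in C) d ord0 (lshift 1 x) + 1.
  move=> /(vcover_with_new GH)/(is_cover_vcover dH).
  by rewrite sum_with_new dv.
(* Entries of [c] are at most [1], so a minimum cover of [G] gives [i <= alpha0 G]. *)
have j_gt0 : 0 < j.
  have [C /cG iC cardC] := alpha0_witness _ G.
  have : \sum_(x in C) c ord0 (lshift 1 x) <= #|C|.
    rewrite -sum1_card; apply: leq_sum => x _.
    by move: (cdE (lshift 1 x)); lia.
  by lia.
(* Dropping [v] costs [d] exactly [1] and [c] nothing; by [j_gt0] the subtraction is not truncated,
   so [i + (j - 1) = alpha0 G]. *)
apply: irr; exists (lsubmx c), (lsubmx d), i, (j - 1); split; last by lia.
- split=> [c0|C /Upsilon_vcover/cG iC]; last by under eq_bigr do rewrite mxE.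
  (* As [c] is already [0] at [v], vanishing on [V(G)] would make it zero. *)
  case: cH => + _; apply; apply/rowP => k; rewrite mxE.
  case: (split_ordP k) => [x ->|y ->]; last by rewrite ord1.
  by move/rowP/(_ x): c0; rewrite !mxE.
- split=> [d0|C /Upsilon_vcover/dG dC]; last first.
    by under eq_bigr do rewrite mxE; lia.
  (* Otherwise the cover [V(G)] of [H] has [d]-weight [0], against [0 < j]. *)
  have := is_cover_vcover dH (vcover_setC_new _ H).
  suff -> : \sum_(k in [set~ rshift n ord0]) d ord0 k = 0 by lia.
  apply: big1 => k.
  case: (split_ordP k) => [x ->|y ->]; last by rewrite ord1 !inE eqxx.
  by move/rowP/(_ x): d0; rewrite !mxE.
- by apply/rowP => x; rewrite !mxE; exact: esym (cdE _).
Qed.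

Theorem proposition3p18 (n : nat) (G : sgraph n) (H : sgraph (n + 1))
    (a : 'rV[nat]_n) (a' : 'rV[nat]_(n + 1)) :
  adds_vertex G H ->
  a = const_mx 1 ->
  a' = row_mx a (const_mx 1) ->
  irreducible_cover (Upsilon G) (alpha0 G) a ->
  alpha0 H = alpha0 G + 1 ->
  a' = const_mx 1 /\ irreducible_cover (Upsilon H) (alpha0 H) a'.
Proof.
move=> GH -> -> [_ irr] alphaH; rewrite row_mx_const; split=> //; split.
  (* The entry at [v] is nonzero even when [n = 0]; the weight of a set under the all-ones vector is
     its cardinality. *)
  split=> [/rowP/(_ (rshift n ord0))|C /Upsilon_vcover/alpha0_le HC].
    by rewrite !mxE.
  by under eq_bigr do rewrite mxE; rewrite sum1_card.
move=> [c [d [i [j [cH dH cd1 ij]]]]]; rewrite alphaH in ij.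
have : c ord0 (rshift n ord0) + d ord0 (rshift n ord0) = 1.
  by move/rowP/(_ (rshift n ord0)): cd1; rewrite !mxE.
(* If [d] is [0] at [v], the two summands exchange roles. *)
case dv: (d ord0 (rshift n ord0)) => [|[|m]] cv; last by lia.
- apply: (ones_not_sum_covers _ G H d c j i) => //; last by lia.
  + by rewrite GRing.addrC.
  + by lia.
- exact: (ones_not_sum_covers _ G H c d i j).
Qed.
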